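(* Let $n\ge 1$ and let $\mathrm{Sym}(n)$ be the symmetric group on $\{1,\dots,n\}$. Consider the action on $\mathrm{Sym}(n)^2$ of the group $\mathrm{Iso}_1(n)\cong \mathrm{Sym}(n)\times \mathbb{Z}/2$ generated by simultaneous conjugations $(\phi,\psi)\mapsto(\alpha\phi\alpha^{-1},\alpha\psi\alpha^{-1})$, $\alpha\in\mathrm{Sym}(n)$, and simultaneous inversion $(\phi,\psi)\mapsto(\phi^{-1},\psi^{-1})$. Then the number $b_n$ of orbits of this action is $$b_n = \frac{1}{2\, n!} \sum_{\alpha \in \mathrm{Sym}(n)} \left[ \left( \sum_{\chi} \chi(\alpha)^2 \right)^2 +\left( \sum_{\chi} \chi(\alpha) \right)^3\right],$$ where the inner sums are over all irreducible complex characters $\chi$ of $\mathrm{Sym}(n)$. *)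

(* Defs.v *)
From HB Require Import structures.
From mathcomp Require Import all_boot all_order all_algebra all_fingroup.
From mathcomp Require Import all_solvable all_field all_character.

Set Implicit Arguments.
Unset Strict Implicit.
Unset Printing Implicit Defensive.

Import GroupScope.

(* In MathComp [phi ^ alpha] is [alpha^-1 * phi * alpha] and permutations are
   composed from left to right, so [phi ^ alpha] is the function
   x |-> alpha (phi (alpha^-1 x)), i.e. the classical "alpha phi alpha^-1". *)
Definition simconj (n : nat) (alpha : 'S_n) (p : 'S_n * 'S_n) : 'S_n * 'S_n :=
  (p.1 ^ alpha, p.2 ^ alpha).

Definition siminv (n : nat) (p : 'S_n * 'S_n) : 'S_n * 'S_n :=
  (p.1^-1, p.2^-1).

(* Sym(n) x Z/2; the group law of ['Z_2] is its addition.  For n <= 2 this group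
   does not act faithfully on Sym(n)^2, so it is kept abstract rather than being
   defined as a group of permutations of Sym(n)^2; [Iso1_perm] below compares
   the two. *)
Definition Iso1 (n : nat) : finGroupType := ('S_n * 'Z_2)%type.

Definition Iso1_fun (n : nat) (p : 'S_n * 'S_n) (g : Iso1 n) : 'S_n * 'S_n :=
  if g.2 == 0%R then simconj g.1 p else siminv (simconj g.1 p).

Lemma simconj1 n (p : 'S_n * 'S_n) : simconj 1 p = p.
Proof. by case: p => x y; rewrite /simconj !conjg1. Qed.

Lemma simconjM n (a b : 'S_n) p : simconj (a * b) p = simconj b (simconj a p).
Proof. by rewrite /simconj !conjgM. Qed.

Lemma siminvK n : involutive (@siminv n).
Proof. by case=> x y; rewrite /siminv /= !invgK. Qed.

Lemma simconjV n (a : 'S_n) p : simconj a (siminv p) = siminv (simconj a p).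
Proof. by rewrite /simconj /siminv /= !conjVg. Qed.

Lemma simconj_inj n (a : 'S_n) : injective (simconj a).
Proof.
by apply: (can_inj (g := simconj a^-1)) => p; rewrite -simconjM mulgV simconj1.
Qed.

Lemma Iso1_is_action n : is_action [set: Iso1 n] (@Iso1_fun n).
Proof.
apply: is_total_action => [p | p [a e] [b f]].
  by rewrite /Iso1_fun simconj1.
rewrite /Iso1_fun /= simconjM.
case: e => [[|[|//]] ie]; case: f => [[|[|//]] jf];
  by rewrite /= ?simconjV ?siminvK.
Qed.

Definition Iso1_action n := Action (Iso1_is_action n).

Lemma Iso1_conj n (alpha : 'S_n) p :
  Iso1_action n p (alpha, 0%R) = simconj alpha p.
Proof. by []. Qed.

Lemma Iso1_inv n p : Iso1_action n p (1, 1%R) = siminv p.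
Proof. by rewrite /= /Iso1_fun /= simconj1. Qed.

Definition Iso1_gens (n : nat) : {set Iso1 n} :=
  ((1, 1%R) : Iso1 n) |: [set ((alpha, 0%R) : Iso1 n) | alpha : 'S_n].

Lemma Iso1_generated n : <<Iso1_gens n>> = [set: Iso1 n].
Proof.
apply/eqP; rewrite eqEsubset subsetT /=; apply/subsetP=> -[a e] _.
have -> : (a, e) = ((a, 0%R) : Iso1 n) * ((1, 1%R) : Iso1 n) ^+ e.
  case: e => [[|[|//]] ie]; rewrite ?expg0 ?expg1 ?mulg1;
    by congr pair; rewrite ?mulg1 //; apply: val_inj.
apply: groupM; [|apply: groupX]; apply/mem_gen/setU1P; [right | by left].
exact: imset_f.
Qed.

Lemma Iso1_perm n :
  actperm (Iso1_action n) @* [set: Iso1 n]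
  = << perm (inv_inj (@siminvK n))
       |: [set perm (@simconj_inj n alpha) | alpha : 'S_n] >>.
Proof.
have -> : actperm (Iso1_action n) @* [set: Iso1 n]
          = actperm (Iso1_action n) @* <<Iso1_gens n>>.
  by rewrite Iso1_generated.
rewrite morphim_gen ?subsetT //; congr << _ >>.
rewrite morphimEsub ?subsetT // imsetU1 -imset_comp; congr (_ |: _).
  by apply/permP=> p; rewrite actpermE permE Iso1_inv.
by apply: eq_imset => a; apply/permP=> p; rewrite /= actpermE permE Iso1_conj.
Qed.

Definition orbit_count (n : nat) : nat :=
  #|orbit (Iso1_action n) [set: Iso1 n] @: [set: 'S_n * 'S_n]|.

(* Main.v *)
(* By Burnside's lemma the count reduces to fixed points.  A pair is fixed by
   [alpha] when both entries commute with it, which gives [#|'C[alpha]| ^ 2];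
   it is fixed by [alpha] followed by inversion when both entries satisfy
   [(g * alpha) ^ 2 = alpha ^ 2], which gives [r (alpha ^ 2) ^ 2], with [r] the
   number of square roots.  Summed over [alpha], the latter is the sum of
   [r ^ 3].  Since every permutation is conjugate to its inverse, the second
   orthogonality relation gives [#|'C[alpha]|] as the sum of the
   ['chi alpha ^ 2]; and [r] is the sum of all irreducible characters once all
   Frobenius-Schur indicators are known to be 1.

   The indicators are computed by induction along the chain of pointwise
   stabilisers.  If [H] is a subgroup of [G] such that each [g] in [G] is
   inverted by conjugation by an element of [H], then, writing [nu_H] for the
   mean over [H] of [chi (h ^ 2)],
     '['Res[H] chi] = nu_G(chi) * nu_H('Res[H] chi).
   For [H = G] this gives [nu_G(chi) = 1] or [-1]; if the indicators of [H] are
   all 1, then [nu_H('Res[H] chi) >= 0], so that [nu_G(chi) = 1]. *)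

Require Import Defs.
From mathcomp Require Import all_boot all_order all_algebra all_fingroup.
From mathcomp Require Import all_solvable all_field all_character.
Import Order.TTheory GRing.Theory Num.Theory.
Local Open Scope ring_scope.

(** * Inverting a permutation by conjugation *)

(* [h] reflects each cycle of [g] about a base point, chosen to be [x] on the
   cycle of [x]. *)
Lemma perm_inv_conj_fix (T : finType) (g : {perm T}) (x : T) :
  exists h : {perm T},
    [/\ (g ^ h = g^-1)%g, h x = x & forall z, g z = z -> h z = z].
Proof.
(* [pick] depends only on the set [porbit g z], so [rep] is constant on cycles; the default [z] is
   never reached, as [z] lies on its own cycle. *)
pose rep z := if z \in porbit g x then x else odflt z [pick y in porbit g z].
have rep_in z : rep z \in porbit g z.
  rewrite /rep; case: ifP => [zx|_]; first by rewrite porbit_sym.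
  by case: pickP => [y //|/(_ z)]; rewrite porbit_id.
have rep_eq y z : porbit g y = porbit g z -> rep y = rep z.
  move=> yz; rewrite /rep yz.
  have -> : (y \in porbit g x) = (z \in porbit g x).
    by rewrite -!eq_porbit_mem yz.
  by case: (z \in _) => //; case: pickP => // /(_ z); rewrite porbit_id.
have kP z : exists k : nat, z == (g ^+ k)%g (rep z).
  have /porbitP[k zk] : z \in porbit g (rep z) by rewrite porbit_sym.
  by exists k; apply/eqP.
pose k z := xchoose (kP z).
have kE z : z = (g ^+ k z)%g (rep z) by apply/eqP; exact: (xchooseP (kP z)).
pose f z := (g ^- k z)%g (rep z).
(* Makes [f] independent of the choice of the exponents [k z]. *)
have inv_eq m l y : (g ^+ m)%g y = (g ^+ l)%g y -> (g ^- m)%g y = (g ^- l)%g y.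
  move=> e; apply: (canLR (permK _)); rewrite -permM.
  have -> : (g ^- l * g ^+ m = g ^+ m * g ^- l)%g.
    by symmetry; apply: commuteV; apply: commuteX2.
  by rewrite permM e permK.
have fM z : f (g z) = (g^-1)%g (f z).
  have rz : rep (g z) = rep z.
    apply: rep_eq; apply/eqP; rewrite eq_porbit_mem.
    by have := mem_porbit g 1 z; rewrite expg1.
  rewrite /f rz -permM -invMg -expgS; apply: inv_eq.
  by rewrite expgSr permM -(kE z) -rz -kE.
have fMX m z : f ((g ^+ m)%g z) = (g ^- m)%g (f z).
  elim: m => [|m IHm]; first by rewrite expg0 invg1 !perm1.
  by rewrite expgSr permM fM IHm -permM -invMg -expgS expgSr.
have frep z : f (rep z) = rep z.
  have rr : rep (rep z) = rep z.
    by apply: rep_eq; apply/eqP; rewrite eq_porbit_mem.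
  rewrite /f rr -[RHS]perm1 -invg1 -(expg0 g); apply: inv_eq.
  by rewrite -{2}rr -kE expg0 perm1.
have fK : involutive f.
  move=> z; rewrite {2}/f.
  have -> : f ((g ^- k z)%g (rep z)) = (g ^+ k z)%g (rep z).
    have := fMX (k z) ((g ^- k z)%g (rep z)); rewrite permKV frep => e.
    by rewrite {2}e permKV.
  by rewrite -kE.
exists (perm (inv_inj fK)); split.
- apply/permP=> z; rewrite -(permKV (perm (inv_inj fK)) z).
  move: ((perm (inv_inj fK))^-1%g z) => w.
  by rewrite permJ !(permE (inv_inj fK)) fM.
- rewrite permE; have rx : rep x = x by rewrite /rep porbit_id.
  by rewrite -{1}rx frep rx.
move=> z gz; rewrite permE.
have gX m : (g ^+ m)%g z = z.
  by elim: m => [|m IHm]; rewrite ?expg0 ?perm1 // expgSr permM IHm.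
have rz : rep z = z by have /porbitP[m ->] := rep_in z.
by rewrite -{1}rz frep rz.
Qed.

(** * Frobenius-Schur indicators of finite groups *)

Section CharacterSums.

Variable gT : finGroupType.
Implicit Types G H : {group gT}.

(* Every irreducible character of [G] has Frobenius-Schur indicator 1, i.e. is
   afforded by a real representation. *)
Definition indicators_eq1 G :=
  forall i : Iirr G, \sum_(g in G) 'chi_i (g * g)%g = #|G|%:R.

(** By Schur's lemma the sum of the matrices [rG (a ^ k)] is scalar, as it commutes with the
    representation; its trace determines the scalar. *)
Lemma sum_irr_conj_mul G (i : Iirr G) (a y : gT) : a \in G -> y \in G ->
  'chi_i 1%g * (\sum_(k in G) 'chi_i (a ^ k * y)%g)
    = #|G|%:R * 'chi_i a * 'chi_i y.
Proof.
move=> Ga Gy.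
have [n [rG absG chiE]] : exists n, exists2 rG : mx_representation algC G n,
    mx_absolutely_irreducible rG & {in G, forall z, 'chi_i z = \tr (rG z)}.
  exists (irr_degree (socle_of_Iirr i)), 'Chi_i => [|z Gz].
    by apply: groupC; apply: socle_irr.
  by rewrite -irrRepr cfunE Gz.
pose M := \sum_(k in G) rG (a ^ k)%g.
have /is_scalar_mxP[c Mc] : is_scalar_mx M.
  apply: (mx_abs_irr_cent_scalar absG).
  apply/centgmxP => z Gz; rewrite mulmx_suml mulmx_sumr.
  rewrite [RHS](reindex_inj (mulIg z)) /=.
  apply: eq_big => [k|k Gk]; first by rewrite groupMr.
  by rewrite -!repr_mxM ?groupJ ?groupM // conjgM -conjgC.
have trM : \tr M = #|G|%:R * 'chi_i a.
  rewrite raddf_sum /= (eq_bigr (fun=> 'chi_i a)); last first.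
    by move=> k Gk; rewrite -chiE ?groupJ // cfunJ.
  by rewrite sumr_const mulr_natl.
have -> : \sum_(k in G) 'chi_i (a ^ k * y)%g = \tr (M *m rG y).
  rewrite mulmx_suml raddf_sum /=; apply: eq_bigr => k Gk.
  by have Gak := groupJ Ga Gk; rewrite chiE ?(groupM Gak) // repr_mxM.
rewrite -trM Mc mul_scalar_mx mxtraceZ mxtrace_scalar -chiE //.
by rewrite chiE // repr_mx1 mxtrace1 mulrA mulr_natl.
Qed.

(** Averaging over the conjugates of [g] leaves the sum unchanged and reduces it to
    [sum_irr_conj_mul] at each [g * g]. *)
Lemma sum_irr_sqr_mul G (i : Iirr G) (y : gT) : y \in G ->
  'chi_i 1%g * (\sum_(g in G) 'chi_i (g * g * y)%g)
    = (\sum_(g in G) 'chi_i (g * g)%g) * 'chi_i y.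
Proof.
move=> Gy; apply: (mulfI (neq0CG G)).
transitivity ('chi_i 1%g *
    \sum_(k in G) \sum_(g in G) 'chi_i ((g * g) ^ k * y)%g).
  rewrite mulrCA; congr (_ * _); rewrite mulr_natl -sumr_const.
  apply: eq_bigr => k Gk; rewrite (reindex_inj (conjg_inj k)) /=.
  by apply: eq_big => [g|g _]; rewrite ?memJ_norm ?conjMg ?(subsetP (normG G)).
rewrite exchange_big /= mulr_sumr mulrA mulr_sumr mulr_suml.
by apply: eq_bigr => g Gg; rewrite sum_irr_conj_mul ?groupM.
Qed.

(* Both sides equal ['chi_i 1] times the sum of ['chi_i (g * g ^ h)] over
   [g \in G] and [h \in H]: since each [g] is inverted by conjugation by an
   element of [H], [g] and [g^-1] have the same [H]-conjugates. *)
Lemma sum_irr_norm_sqr G H (i : Iirr G) : H \subset G ->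
    {in G, forall g, exists2 h, h \in H & (g ^ h = g^-1)%g} ->
  #|G|%:R * \sum_(h in H) `|'chi_i h| ^+ 2
    = (\sum_(g in G) 'chi_i (g * g)%g) * \sum_(h in H) 'chi_i (h * h)%g.
Proof.
move=> sHG invH.
transitivity ('chi_i 1%g *
    \sum_(g in G) \sum_(h in H) 'chi_i (g^-1 * g ^ h)%g).
  rewrite exchange_big /= mulr_sumr mulr_sumr (reindex_inj invg_inj) /=.
  apply: eq_big => [h|h]; rewrite groupV // => Hh.
  have Gh := subsetP sHG h Hh.
  rewrite normCK -irr_inv invgK mulrA -sum_irr_conj_mul ?groupV //.
  congr (_ * _); apply: eq_bigr => g Gg; congr ('chi_i _).
  by rewrite !conjgE !mulgA.
have -> : \sum_(g in G) \sum_(h in H) 'chi_i (g^-1 * g ^ h)%g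
        = \sum_(g in G) \sum_(h in H) 'chi_i (g * g ^ h)%g.
  rewrite [RHS](reindex_inj invg_inj) /=.
  apply: eq_big => [g|g Gg]; first by rewrite groupV.
  have [h0 Hh0 gh0] := invH g Gg.
  rewrite -gh0 (reindex_inj (mulgI h0)) /= gh0.
  apply: eq_big => [h|h _]; first by rewrite groupMl.
  by rewrite conjgM gh0.
rewrite exchange_big /= mulr_sumr mulr_sumr.
apply: eq_bigr => h Hh; have Gh := subsetP sHG h Hh.
rewrite -sum_irr_sqr_mul ?groupM //; congr (_ * _).
rewrite (reindex_inj (mulIg h)) /=.
apply: eq_big => [g|g Gg]; first by rewrite groupMr.
by congr ('chi_i _); rewrite conjgE !mulgA mulgK.
Qed.

Lemma indicators_eq1_extend G H : H \subset G ->
    {in G, forall g, exists2 h, h \in H & (g ^ h = g^-1)%g} ->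
  indicators_eq1 H -> indicators_eq1 G.
Proof.
move=> sHG invH sqrH i; set s := LHS.
(* The restriction is a combination of irreducible characters of [H], all of indicator 1, with
   natural coefficients. *)
have ResH_ge0 : 0 <= \sum_(h in H) 'chi_i (h * h)%g.
  have chR : 'Res[H] 'chi_i \is a character by rewrite cfRes_char ?irr_char.
  rewrite (eq_bigr (fun h =>
      \sum_j '['Res[H] 'chi_i, 'chi_j] * 'chi_j (h * h)%g)).
    rewrite exchange_big /= sumr_ge0 // => j _; rewrite -mulr_sumr sqrH.
    by rewrite mulr_ge0 ?ler0n // natr_ge0 // Cnat_cfdot_char_irr.
  move=> h Hh; rewrite -(cfResE _ sHG) ?groupM //.
  rewrite [in LHS](cfun_sum_cfdot ('Res[H] 'chi_i)) sum_cfunE.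
  by apply: eq_bigr => j _; rewrite cfunE.
have invG : {in G, forall g, exists2 h, h \in G & (g ^ h = g^-1)%g}.
  by move=> g /invH[h Hh gh]; exists h => //; apply: (subsetP sHG).
have s2 : s ^+ 2 = #|G|%:R ^+ 2.
  rewrite [LHS]expr2 -sum_irr_norm_sqr //.
  have := cfnorm_irr i; rewrite cfdotE => /(canRL (mulVKf (neq0CG G))).
  rewrite mulr1 (eq_bigr (fun x => `|'chi_i x| ^+ 2)) => [->|x _].
    by rewrite expr2.
  by rewrite normCK.
have /eqP := s2; rewrite eqf_sqr => /orP[/eqP // | /eqP sN].
have: 0 < #|G|%:R * \sum_(h in H) `|'chi_i h| ^+ 2.
  rewrite mulr_gt0 ?gt0CG // (bigD1 1%g) //= ltr_pwDl //.
    by rewrite exprn_gt0 // normr_gt0 irr1_neq0.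
  by rewrite sumr_ge0 // => h _; rewrite exprn_ge0.
rewrite (sum_irr_norm_sqr _ _ _ sHG invH) -/s sN mulNr oppr_gt0 => lt0.
by have := mulr_ge0 (ler0n _ #|G|) ResH_ge0; rewrite (lt_geF lt0).
Qed.

(** Grouping the indicator sum of ['chi_i] by the value of [g * g] shows that the root count, a
    class function, has coefficient 1 on each ['chi_i]. *)
Lemma card_sqr_root_irr G (x : gT) : x \in G -> indicators_eq1 G ->
  #|[set g in G | g * g == x]%g|%:R = \sum_(i : Iirr G) 'chi_i x :> algC.
Proof.
move=> Gx sqrG; pose r z := #|[set g in G | g * g == z]%g|%:R : algC.
have cl_r : is_class_fun <<G>>%g [ffun z => r z].
  rewrite genGid; apply: intro_class_fun => [z k Gz Gk | z nGz].
    rewrite /r -(cardJg [set g in G | g * g == z]%g k).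
    congr (#|(_ : {set gT})|%:R).
    apply/setP=> g; rewrite mem_conjg !inE groupJr ?groupV // -conjMg.
    by rewrite (can2_eq (conjgKV k) (conjgK k)).
  rewrite /r (_ : [set g in G | _] = set0) ?cards0 //; apply/setP=> g.
  by rewrite !inE; apply: contraNF nGz => /andP[Gg /eqP <-]; rewrite groupM.
rewrite -/(r x) -[LHS](cfunE cl_r) [Cfun _ _]cfun_sum_cfdot sum_cfunE.
apply: eq_bigr => i _; rewrite cfunE cfdotE.
suff -> : \sum_(z in G) Cfun 0 cl_r z * ('chi_i z)^* = #|G|%:R.
  by rewrite mulVf ?neq0CG // mul1r.
rewrite -[RHS]conjC_nat -(sqrG i) rmorph_sum /=.
rewrite [RHS](partition_big (fun g => g * g)%g [in G]) => [|g Gg]; last first.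
  exact: groupM.
apply: eq_bigr => z Gz; rewrite cfunE /r mulr_natl -sumr_const.
by apply: eq_big => [g|g]; rewrite inE // => /andP[_ /eqP ->].
Qed.

End CharacterSums.

(** * Character sums of the symmetric group *)

(** Induction on the size of the complement of [A]: the inverting element can be chosen to fix one
    more point [x]. *)
Lemma indicators_eq1_astab (T : finType) (A : {set T}) :
  indicators_eq1 _ 'C(A | 'P)%G.
Proof.
have [m] := ubnP #|~: A|; elim: m A => // m IHm A leAm.
have [/setP A_T|[x xA]] := set_0Vmem (~: A).
  have C1 : 'C(A | 'P)%G = 1%G :> {group {perm T}}.
    apply/val_inj/trivgP/subsetP => g /astabP gA; rewrite inE.
    apply/eqP/permP=> z.
    by rewrite perm1; apply: (gA z); have := A_T z; rewrite !inE => /negbFE.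
  rewrite C1 => i; rewrite big_set1 cards1 mulg1 lin_char1 //.
  exact/char_abelianP/abelian1.
rewrite inE in xA.
apply: (indicators_eq1_extend _ 'C(A | 'P)%G 'C(x |: A | 'P)%G).
- by apply: astabS; apply: subsetUr.
- move=> g /astabP gA; have [h [gh hx hfix]] := perm_inv_conj_fix T g x.
  exists h => //; apply/astabP=> z /setU1P[-> //|/gA gz].
  exact: hfix.
apply: IHm; rewrite -ltnS (leq_trans _ leAm) // ltnS proper_card //.
rewrite setCU properEneq subsetIr andbT.
by apply/eqP => /setP/(_ x); rewrite !inE eqxx xA.
Qed.

Lemma indicators_eq1_Sn n : indicators_eq1 _ [set: 'S_n]%G.
Proof.
suff <- : 'C(set0 | 'P)%G = [set: 'S_n]%G by apply: indicators_eq1_astab.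
by apply/group_inj/setP => g; rewrite [RHS]inE; apply/astabP=> z; rewrite inE.
Qed.

Lemma card_sqr_root_Sn n (x : 'S_n) :
  #|[set g | g * g == x]%g|%:R = \sum_(i : Iirr [set: 'S_n]) 'chi_i x.
Proof.
rewrite -(card_sqr_root_irr _ _ _ (in_setT x) (indicators_eq1_Sn n)).
by congr _%:R; apply: eq_card => g; rewrite !inE.
Qed.

Lemma perm_conj_inv (T : finType) (g : {perm T}) : (g^-1 \in g ^: setT)%g.
Proof.
(* A base point is needed; on an empty [T] the only permutation is the identity. *)
case: (pickP T) => [x _ | T0].
  have [h [<- _ _]] := perm_inv_conj_fix T g x.
  by rewrite memJ_class ?inE.
suff -> : g^-1%g = g by apply: class_refl.
by apply/permP => z; have := T0 z.
Qed.

Lemma sum_irr_sqr_Sn n (x : 'S_n) :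
  \sum_(i : Iirr [set: 'S_n]) 'chi_i x ^+ 2 = #|'C[x]%g|%:R.
Proof.
have := second_orthogonality_relation (G := [set: 'S_n]) x (in_setT x^-1%g).
have := perm_conj_inv _ x^-1%g; rewrite invgK => ->; rewrite setTI mulr1n => <-.
by apply: eq_bigr => i _; rewrite irr_inv conjCK expr2.
Qed.

(** * Fixed points and the orbit count *)

(* Right translation by [x] is a bijection: [g ^ x = g^-1] says that
   [(g * x) ^ 2 = x ^ 2]. *)
Lemma card_conj_inv (gT : finGroupType) (x : gT) :
  #|[set g | g ^ x == g^-1]%g| = #|[set g | g * g == x * x]%g|.
Proof.
rewrite -(card_imset _ (mulIg x)); apply: eq_card => y.
rewrite -[y](mulgKV x) (mem_imset _ _ (mulIg x)) !inE.
move: (y * x^-1)%g => g; apply/eqP/eqP => [gx|].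
  by rewrite mulgA {1}conjgC gx mulgKV.
rewrite mulgA => /mulIg gxg; rewrite conjgE.
by apply: (canLR (mulKg x)); apply: (canRL (mulgK g)).
Qed.

Lemma card_fix_conj n (a : 'S_n) :
  #|'Fix_(setT | Iso1_action n)[(a, 0%R)]%g| = (#|'C[a]%g| ^ 2)%N.
Proof.
rewrite expnS expn1 -cardsX; apply: eq_card => p.
rewrite setTI (sameP afix1P eqP) Iso1_conj /simconj inE.
by rewrite [X in _ == X]surjective_pairing xpair_eqE; congr (_ && _);
  rewrite (sameP eqP conjg_fixP) (sameP commgP cent1P) cent1C.
Qed.

Lemma card_fix_conj_inv n (a : 'S_n) :
  #|'Fix_(setT | Iso1_action n)[(a, 1%R)]%g|
    = (#|[set g : 'S_n | g * g == a * a]%g| ^ 2)%N.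
Proof.
rewrite -card_conj_inv expnS expn1 -cardsX; apply: eq_card => p.
rewrite setTI (sameP afix1P eqP) /= /Iso1_fun /= /siminv /= !inE.
by rewrite [X in _ == X]surjective_pairing xpair_eqE !(inv_eq invgK).
Qed.

(** Each [b] is the square of as many [a] as it has roots, and all these [a] contribute the same
    term. *)
Lemma sum_card_sqr_root (gT : finGroupType) :
  (\sum_(a : gT) #|[set g : gT | g * g == a * a]%g| ^ 2
    = \sum_(a : gT) #|[set g | g * g == a]%g| ^ 3)%N.
Proof.
rewrite (partition_big (fun a => a * a)%g xpredT) //=.
apply: eq_bigr => b _.
rewrite (eq_bigr (fun=> #|[set g | g * g == b]%g| ^ 2)%N) => [|a /eqP-> //].
rewrite sum_nat_const expnS; congr (_ * _)%N.
by apply: eq_card => a; rewrite inE.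
Qed.

Theorem proposition3p2 (n : nat) (hn : (1 <= n)%N) :
  (orbit_count n)%:R =
    1 / (2 * n`!%:R) *
    \sum_(alpha : 'S_n)
      ((\sum_(i : Iirr [set: 'S_n]) 'chi_i alpha ^+ 2) ^+ 2
       + (\sum_(i : Iirr [set: 'S_n]) 'chi_i alpha) ^+ 3) :> algC.
Proof.
have nf0 : 2 * n`!%:R != 0 :> algC.
  by rewrite mulf_neq0 ?pnatr_eq0 // -lt0n fact_gt0.
rewrite div1r; apply: (canRL (mulKf nf0)).
have -> : 2 * n`!%:R = #|[set: Iso1 n]|%:R :> algC.
  by rewrite cardsT card_prod card_Sn card_ord mulnC natrM.
have actsT : [acts [set: Iso1 n], on setT | Iso1_action n]%g.
  by apply/actsP => a _ z; rewrite !inE.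
rewrite -natrM mulnC -(Frobenius_Cauchy actsT).
have -> : (\sum_(a in [set: Iso1 n]) #|'Fix_(setT | Iso1_action n)[a]%g|
           = \sum_(a : 'S_n) #|'C[a]%g| ^ 2
             + \sum_(a : 'S_n) #|[set g | g * g == a]%g| ^ 3)%N.
  rewrite -sum_card_sqr_root -big_split /=.
  transitivity (\sum_(a : 'S_n) \sum_(e : 'Z_2)
      #|'Fix_(setT | Iso1_action n)[(a, e)]%g|)%N.
    by rewrite pair_bigA; apply: eq_big => [p|[a e] _]; rewrite ?inE.
  apply: eq_bigr => a _; rewrite big_ord_recl big_ord1 /=.
  have -> : lift ord0 ord0 = 1%R :> 'Z_2 by apply: val_inj.
  by rewrite -card_fix_conj -card_fix_conj_inv.
rewrite natrD !natr_sum big_split; congr (_ + _); apply: eq_bigr => a _.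
  by rewrite natrX sum_irr_sqr_Sn.
by rewrite natrX card_sqr_root_Sn.
Qed.
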